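(* Let $\mathcal{Q}$ be a small quantaloid and let $F\colon\mathbb{A}\to\mathbb{B}$ be a functor between $\mathcal{Q}$-categories, with $\mathbb{A}$ tensored. Then the following are equivalent: (1) $F$ is a left adjoint in $\mathrm{Cat}(\mathcal{Q})$; (2) $F$ preserves tensors and, for all $\mathcal{Q}$-objects $X$, the order-preserving map $F\colon\mathbb{A}_X\to\mathbb{B}_X$, $a\mapsto Fa$, is a left adjoint in $\mathrm{Cat}(\mathbf{2})$.
   Context: A quantaloid is a category whose hom-sets are complete lattices and whose composition preserves arbitrary suprema in each variable separately. For $f\colon X\to Y$ and $g\colon Z\to Y$, $[f,g]\colon Z\to X$ is the largest $h$ with $f\circ h\le g$. A $\mathcal{Q}$-category $\mathbb{C}$ consists of a small set $\mathbb{C}_0$ of objects, a type $tx\in\mathcal{Q}_0$ for each $x\in\mathbb{C}_0$, and hom-arrows $\mathbb{C}(y,x)\colon tx\to ty$ with $1_{tx}\le\mathbb{C}(x,x)$ and $\mathbb{C}(z,y)\circ\mathbb{C}(y,x)\le\mathbb{C}(z,x)$. A functor $F\colon\mathbb{A}\to\mathbb{B}$ is a type-preserving map on objects with $\mathbb{A}(a',a)\le\mathbb{B}(Fa',Fa)$. An order is a reflexive transitive relation; $x'\le x$ in $\mathbb{C}$ means $tx'=tx=X$ and $1_X\le\mathbb{C}(x',x)$; $\mathbb{C}_X$ is the ordered set of objects of $\mathbb{C}$ of type $X$. $\mathrm{Cat}(\mathcal{Q})$ is the locally ordered 2-category of $\mathcal{Q}$-categories and functors, with $F\le G$ iff $Fx\le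 Gx$ for all objects $x$. $F\colon\mathbb{A}\to\mathbb{B}$ is left adjoint in $\mathrm{Cat}(\mathcal{Q})$ if there is a functor $G\colon\mathbb{B}\to\mathbb{A}$ with $1_{\mathbb{A}}\le G\circ F$ and $F\circ G\le 1_{\mathbb{B}}$. $\mathrm{Cat}(\mathbf{2})$ is the 2-category of orders and order-preserving maps; adjoints there are the usual adjoints (Galois connections). Tensors: for $f\colon X\to Y$ in $\mathcal{Q}$ and $y\in\mathbb{C}_Y$, $y\otimes f$ is (if it exists) an object of type $X$ with $\mathbb{C}(y\otimes f,z)=[f,\mathbb{C}(y,z)]$ for all $z\in\mathbb{C}_0$. $\mathbb{C}$ is tensored if all tensors exist. $F\colon\mathbb{A}\to\mathbb{B}$ preserves tensors if, whenever $a\otimes f$ is a tensor in $\mathbb{A}$, $F(a\otimes f)$ is the tensor of $Fa$ and $f$ in $\mathbb{B}$. *)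

(* Defs.v *)
From Stdlib Require Import Setoid RelationClasses Relation_Definitions.

Set Implicit Arguments.
Unset Strict Implicit.
Unset Printing Implicit Defensive.

(* [comp g f] is "g after f".  A complete lattice is a partial order in which
   every subset has a supremum; suprema are unique by antisymmetry, so carrying
   [sup] as an operation adds no structure. *)
Record quantaloid := Quantaloid {
  qobj : Type;
  hom : qobj -> qobj -> Type;
  idm : forall X, hom X X;
  comp : forall X Y Z, hom Y Z -> hom X Y -> hom X Z;
  comp_assoc : forall W X Y Z (h : hom Y Z) (g : hom X Y) (f : hom W X),
    comp h (comp g f) = comp (comp h g) f;
  comp_idl : forall X Y (f : hom X Y), comp (idm Y) f = f;
  comp_idr : forall X Y (f : hom X Y), comp f (idm X) = f;
  qle : forall X Y, relation (hom X Y);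
  qle_order : forall X Y, order (hom X Y) (@qle X Y);
  sup : forall X Y, (hom X Y -> Prop) -> hom X Y;
  sup_ub : forall X Y (S : hom X Y -> Prop) f, S f -> qle f (sup S);
  sup_least : forall X Y (S : hom X Y -> Prop) u,
    (forall f, S f -> qle f u) -> qle (sup S) u;
  comp_supl : forall X Y Z (S : hom Y Z -> Prop) (f : hom X Y),
    comp (sup S) f = sup (fun h => exists g, S g /\ h = comp g f);
  comp_supr : forall X Y Z (g : hom Y Z) (S : hom X Y -> Prop),
    comp g (sup S) = sup (fun h => exists f, S f /\ h = comp g f)
}.

Arguments hom {q} X Y.
Arguments idm {q} X.
Arguments comp {q X Y Z} g f.
Arguments qle {q X Y} f g.
Arguments sup {q X Y} S.

Declare Scope quantaloid_scope.
Delimit Scope quantaloid_scope with Q.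
Open Scope quantaloid_scope.
Notation "g \o f" := (comp g f) (at level 40, left associativity)
  : quantaloid_scope.
Notation "f <=q g" := (qle f g) (at level 70, no associativity)
  : quantaloid_scope.

Lemma qle_refl (Q : quantaloid) (X Y : qobj Q) (f : hom X Y) : f <=q f.
Proof. apply (ord_refl _ _ (qle_order X Y)). Qed.

Lemma qle_trans (Q : quantaloid) (X Y : qobj Q) (f g h : hom X Y) :
  f <=q g -> g <=q h -> f <=q h.
Proof. apply (ord_trans _ _ (qle_order X Y)). Qed.

Lemma qle_antisym (Q : quantaloid) (X Y : qobj Q) (f g : hom X Y) :
  f <=q g -> g <=q f -> f = g.
Proof. apply (ord_antisym _ _ (qle_order X Y)). Qed.

Lemma comp_monor (Q : quantaloid) (X Y Z : qobj Q) (g : hom Y Z)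
    (f f' : hom X Y) : f <=q f' -> g \o f <=q g \o f'.
Proof.
intros le_ff'.
assert (E : sup (fun h => h = f \/ h = f') = f').
{ apply qle_antisym.
  - apply sup_least; intros h [-> | ->]; [exact le_ff' | apply qle_refl].
  - apply sup_ub; now right. }
rewrite <- E, comp_supr.
apply sup_ub; exists f; split; [now left | reflexivity].
Qed.

Lemma comp_monol (Q : quantaloid) (X Y Z : qobj Q) (g g' : hom Y Z)
    (f : hom X Y) : g <=q g' -> g \o f <=q g' \o f.
Proof.
intros le_gg'.
assert (E : sup (fun h => h = g \/ h = g') = g').
{ apply qle_antisym.
  - apply sup_least; intros h [-> | ->]; [exact le_gg' | apply qle_refl].
  - apply sup_ub; now right. }
rewrite <- E, comp_supl.
apply sup_ub; exists g; split; [now left | reflexivity].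
Qed.

(* [lifting f g] is [f, g] : Z -> X, the largest h with f \o h <= g (see
   [lifting_le] and [lifting_largest]). *)
Definition lifting (Q : quantaloid) (X Y Z : qobj Q)
    (f : hom X Y) (g : hom Z Y) : hom Z X :=
  sup (fun h : hom Z X => f \o h <=q g).

Lemma lifting_le (Q : quantaloid) (X Y Z : qobj Q)
    (f : hom X Y) (g : hom Z Y) : f \o lifting f g <=q g.
Proof.
unfold lifting; rewrite comp_supr.
apply sup_least; intros h [k [Hk ->]]; exact Hk.
Qed.

Lemma lifting_largest (Q : quantaloid) (X Y Z : qobj Q)
    (f : hom X Y) (g : hom Z Y) (h : hom Z X) :
  f \o h <=q g -> h <=q lifting f g.
Proof. intros Hh; apply (sup_ub (S := fun k => f \o k <=q g)); exact Hh. Qed.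

(* The typed set of objects (C_0, t : C_0 -> Q_0) is given by its fibres:
   [ob C X] is the set C_X of objects of type X, so that C_0 is
   {X : qobj Q & ob C X} and t is the first projection.  "Type-preserving map"
   then becomes a typing condition, and no transport along an equation
   t x' = t x is needed. *)
Record qcat (Q : quantaloid) := QCat {
  ob : qobj Q -> Type;
  (* [harr y x] is C(y, x) : tx -> ty, with the codomain object first. *)
  harr : forall X Y, ob Y -> ob X -> hom X Y;
  harr_id : forall X (x : ob X), idm X <=q harr x x;
  harr_comp : forall X Y Z (x : ob X) (y : ob Y) (z : ob Z),
    harr z y \o harr y x <=q harr z x
}.

Arguments ob {Q} C X : rename.
Arguments harr {Q} C {X Y} y x : rename.

Record functor (Q : quantaloid) (A B : qcat Q) := Functor {
  fob : forall X, ob A X -> ob B X;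
  fob_le : forall X Y (a : ob A X) (a' : ob A Y),
    harr A a' a <=q harr B (fob a') (fob a)
}.

Arguments fob {Q A B} F {X} a : rename.

Definition functor_id (Q : quantaloid) (A : qcat Q) : functor A A :=
  {| fob := fun _ a => a;
     fob_le := fun _ _ a a' => qle_refl (harr A a' a) |}.

Definition functor_comp (Q : quantaloid) (A B C : qcat Q)
    (G : functor B C) (F : functor A B) : functor A C :=
  {| fob := fun _ a => fob G (fob F a);
     fob_le := fun _ _ a a' =>
       qle_trans (fob_le F a a') (fob_le G (fob F a) (fob F a')) |}.

(* x' <= x for two objects of the same type X. *)
Definition ob_le (Q : quantaloid) (C : qcat Q) (X : qobj Q)
    (x' x : ob C X) : Prop :=
  idm X <=q harr C x' x.

Definition functor_le (Q : quantaloid) (A B : qcat Q) (F G : functor A B) :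
    Prop :=
  forall X (a : ob A X), ob_le (fob F a) (fob G a).

Definition is_left_adjoint (Q : quantaloid) (A B : qcat Q) (F : functor A B) :
    Prop :=
  exists G : functor B A,
    functor_le (functor_id A) (functor_comp G F) /\
    functor_le (functor_comp F G) (functor_id B).

(* Orders are not assumed antisymmetric. *)
Record ordset := OrdSet {
  carrier : Type;
  ole : relation carrier;
  ole_preorder : PreOrder ole
}.

Arguments ole {P} x y : rename.

Record omap (P R : ordset) := OMap {
  ofun : carrier P -> carrier R;
  ofun_mono : forall x y, ole x y -> ole (ofun x) (ofun y)
}.

Arguments ofun {P R} f x : rename.

Definition omap_is_left_adjoint (P R : ordset) (f : omap P R) : Prop :=
  exists g : omap R P,
    (forall x : carrier P, ole x (ofun g (ofun f x))) /\
    (forall y : carrier R, ole (ofun f (ofun g y)) y).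

Lemma ob_le_preorder (Q : quantaloid) (C : qcat Q) (X : qobj Q) :
  PreOrder (@ob_le Q C X).
Proof.
split.
- intros x; apply harr_id.
- intros x y z Hxy Hyz; unfold ob_le in *.
  eapply qle_trans; [| apply (harr_comp z y x)].
  eapply qle_trans; [exact Hyz |].
  rewrite <- (comp_idl (harr C y z)) at 1.
  apply comp_monol; exact Hxy.
Qed.

Definition fibre (Q : quantaloid) (C : qcat Q) (X : qobj Q) : ordset :=
  {| carrier := ob C X; ole := @ob_le Q C X;
     ole_preorder := ob_le_preorder C X |}.

Lemma fob_mono (Q : quantaloid) (A B : qcat Q) (F : functor A B)
    (X : qobj Q) (a' a : ob A X) :
  ob_le a' a -> ob_le (fob F a') (fob F a).
Proof. intros Ha; eapply qle_trans; [exact Ha | apply fob_le]. Qed.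

Definition fibre_map (Q : quantaloid) (A B : qcat Q) (F : functor A B)
    (X : qobj Q) : omap (fibre A X) (fibre B X) :=
  @OMap (fibre A X) (fibre B X) (fun a => fob F a) (fob_mono F (X := X)).

(* [t] is a tensor of [y] and [f] (tensors are unique only up to
   isomorphism). *)
Definition is_tensor (Q : quantaloid) (C : qcat Q) (X Y : qobj Q)
    (y : ob C Y) (f : hom X Y) (t : ob C X) : Prop :=
  forall Z (z : ob C Z), harr C t z = lifting f (harr C y z).

Definition tensored (Q : quantaloid) (C : qcat Q) : Prop :=
  forall X Y (y : ob C Y) (f : hom X Y), exists t : ob C X, is_tensor y f t.

Definition preserves_tensors (Q : quantaloid) (A B : qcat Q)
    (F : functor A B) : Prop :=
  forall X Y (a : ob A Y) (f : hom X Y) (t : ob A X),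
    is_tensor a f t -> is_tensor (fob F a) f (fob F t).

(* Main.v *)
From Stdlib Require Import RelationClasses IndefiniteDescription.
Require Import Defs.

(** A left adjoint [F] with right adjoint [G] is governed by the equality of
    hom-arrows A(a, G b) = B(F a, b) ([adjoint_harrE]), and any type-preserving
    map on objects satisfying this equality is automatically a right adjoint
    functor ([left_adjoint_of_harrE]).

    If [F] has a right adjoint [G], the equality turns the universal property
    A(a (x) f, G z) = [f, A(a, G z)] of a tensor in [A] into that of its image
    in [B]; and [G], restricted to objects of type [X], is right adjoint to [F]
    on the fibres over [X].

    Conversely, fibrewise adjoints supply the map on objects [G], and the order
    relations of the fibres only record which hom-arrows lie above an identity.
    Tensors are what brings an arbitrary arrow f : Y -> X within their reach: f <= A(a, x)
    holds exactly when a (x) f <= x in the fibre over [Y] ([tensor_leP]).  Hence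
    the fibrewise adjunction, applied to a (x) f with f = B(F a, b), gives
    B(F a, b) <= A(a, G b) as soon as [F] preserves that tensor
    ([harr_le_of_fibrewise]). *)

Section HomArrows.

Context {Q : quantaloid}.

Lemma harr_le_right (C : qcat Q) (X Y : qobj Q) (x : ob C X) (y y' : ob C Y) :
  ob_le y y' -> harr C x y <=q harr C x y'.
Proof.
intros le_yy'.
apply qle_trans with (2 := harr_comp y' y x).
rewrite <- (comp_idr (harr C x y)) at 1.
apply comp_monor; exact le_yy'.
Qed.

Lemma harr_le_left (C : qcat Q) (X Y : qobj Q) (x x' : ob C X) (y : ob C Y) :
  ob_le x x' -> harr C x' y <=q harr C x y.
Proof.
intros le_xx'.
apply qle_trans with (2 := harr_comp y x' x).
rewrite <- (comp_idl (harr C x' y)) at 1.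
apply comp_monol; exact le_xx'.
Qed.

Lemma id_le_liftingP (X Y : qobj Q) (f g : hom X Y) :
  idm X <=q lifting f g <-> f <=q g.
Proof.
split.
- intros le_1.
  apply qle_trans with (2 := lifting_le f g).
  rewrite <- (comp_idr f) at 1.
  apply comp_monor; exact le_1.
- intros le_fg; apply lifting_largest; rewrite comp_idr; exact le_fg.
Qed.

(** The underlying-order shadow of the universal property of a tensor: it
    encodes an inequality between arrows X -> Y in the order of the fibre
    over X. *)
Lemma tensor_leP (C : qcat Q) (X Y : qobj Q) (y : ob C Y) (f : hom X Y)
    (t x : ob C X) :
  is_tensor y f t -> (ob_le t x <-> f <=q harr C y x).
Proof. intros tens; unfold ob_le; rewrite tens; apply id_le_liftingP. Qed.

Context {A B : qcat Q} (F : functor A B).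

(** Stated for one pair of objects, so that it applies both to a right adjoint
    functor, with [u] = G b, and to a map on objects assembled from adjoints on
    the separate fibres. *)
Lemma harr_counit_le (X Y : qobj Q) (a : ob A X) (u : ob A Y) (b : ob B Y) :
  ob_le (fob F u) b -> harr A a u <=q harr B (fob F a) b.
Proof.
intros le_Fub.
apply qle_trans with (1 := fob_le F u a).
apply harr_le_right; exact le_Fub.
Qed.

Lemma adjoint_harrE (G : functor B A) :
  functor_le (functor_id A) (functor_comp G F) ->
  functor_le (functor_comp F G) (functor_id B) ->
  forall X Y (a : ob A X) (b : ob B Y),
    harr A a (fob G b) = harr B (fob F a) b.
Proof.
intros unit counit X Y a b; apply qle_antisym.
- apply harr_counit_le; exact (counit Y b).
- apply qle_trans with (1 := fob_le G b (fob F a)).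
  apply harr_le_left; exact (unit X a).
Qed.

(** The unit and counit come from [harr_id] at [F a] and [G b], read through
    the equality; the counit then makes the map on objects a functor, since
    B(b', b) <= B(F (G b'), b) = A(G b', G b). *)
Lemma left_adjoint_of_harrE (G : forall Y, ob B Y -> ob A Y) :
  (forall X Y (a : ob A X) (b : ob B Y),
     harr A a (G Y b) = harr B (fob F a) b) ->
  is_left_adjoint F.
Proof.
intros GE.
assert (counit : forall Y (b : ob B Y), ob_le (fob F (G Y b)) b).
{ intros Y b; unfold ob_le; rewrite <- GE; apply harr_id. }
assert (G_le : forall X Y (b : ob B X) (b' : ob B Y),
          harr B b' b <=q harr A (G Y b') (G X b)).
{ intros X Y b b'; rewrite GE; apply harr_le_left, counit. }
exists (Functor G_le); split.
- intros X a; unfold ob_le; simpl; rewrite GE; apply harr_id.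
- intros Y b; apply counit.
Qed.

Lemma left_adjoint_preserves_tensors :
  is_left_adjoint F -> preserves_tensors F.
Proof.
intros [G [unit counit]] X Y a f t tens Z z.
rewrite <- !(adjoint_harrE G unit counit).
apply tens.
Qed.

Lemma left_adjoint_fibrewise (X : qobj Q) :
  is_left_adjoint F -> omap_is_left_adjoint (fibre_map F X).
Proof.
intros [G [unit counit]]; exists (fibre_map G X); split.
- exact (unit X).
- exact (counit X).
Qed.

(** The tensor of [a] with the arrow B(F a, b) lies below [b] after applying
    [F], by [tensor_leP] in [B]; transposing along the adjunction in the single
    fibre of [b] puts it below [g b], and [tensor_leP] in [A] concludes. *)
Lemma harr_le_of_fibrewise (Y : qobj Q) (g : omap (fibre B Y) (fibre A Y)) :
  tensored A -> preserves_tensors F ->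
  (forall a : ob A Y, ob_le a (ofun g (fob F a))) ->
  forall X (a : ob A X) (b : ob B Y),
    harr B (fob F a) b <=q harr A a (ofun g b).
Proof.
intros tensA presF unit X a b.
destruct (tensA Y X a (harr B (fob F a) b)) as [t tens].
assert (le_Ftb : ob_le (fob F t) b).
{ apply (tensor_leP _ _ _ _ _ _ _ (presF _ _ _ _ _ tens)), qle_refl. }
apply (tensor_leP _ _ _ _ _ _ _ tens).
apply (PreOrder_Transitive (PreOrder := ob_le_preorder A Y)
         _ (ofun g (fob F t))).
- apply unit.
- exact (ofun_mono g le_Ftb).
Qed.

End HomArrows.

Theorem theorem3p1 (Q : quantaloid) (A B : qcat Q) (F : functor A B)
    (hA : tensored A) :
  is_left_adjoint F <->
  (preserves_tensors F /\
   forall X : qobj Q, omap_is_left_adjoint (fibre_map F X)).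
Proof.
split.
- intros adjF; split.
  + apply left_adjoint_preserves_tensors; exact adjF.
  + intros X; apply left_adjoint_fibrewise; exact adjF.
- intros [presF adjF].
  (* A functor needs one adjoint picked for every type at once: this is where
     the axiom of choice enters. *)
  pose (g := fun X => proj1_sig (constructive_indefinite_description _ (adjF X))).
  assert (adj_g : forall X,
    (forall a : ob A X, ob_le a (ofun (g X) (fob F a))) /\
    (forall b : ob B X, ob_le (fob F (ofun (g X) b : ob A X)) b)).
  { intros X; exact (proj2_sig (constructive_indefinite_description _ (adjF X))). }
  apply (left_adjoint_of_harrE F (fun Y b => ofun (g Y) b)).
  intros X Y a b; apply qle_antisym.
  + apply harr_counit_le, (adj_g Y).
  + apply harr_le_of_fibrewise; [exact hA | exact presF | apply (adj_g Y)].
Qed.
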